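(* Let $f$ be a proper landscape. Then for any $(x,t;y,s)\in\mathbb R^4_\uparrow$ there exist a rightmost geodesic and a leftmost geodesic in $f$ from $(x,t)$ to $(y,s)$.
   Context: Let $\mathbb R^4_\uparrow=\{(x,t;y,s)\in\mathbb R^4:t<s\}$. A function $f:\mathbb R^4_\uparrow\to\mathbb R\cup\{-\infty\}$ is a landscape if for every $x,y\in\mathbb R$ and $s<r<t$, $$f(x,s;y,t)=\max_{z\in\mathbb R}\,[f(x,s;z,r)+f(z,r;y,t)].\qquad( * )$$ A real-valued landscape $f$ is proper if: (i) $f$ is continuous; (ii) for every bounded set $[-b,b]^4\cap\mathbb R^4_\uparrow$ there is a constant $c_b$ such that $\left|f(x,t;y,t+s)+\frac{(x-y)^2}{s}\right|\le c_b$ for all $(x,t;y,t+s)\in[-b,b]^4\cap\mathbb R^4_\uparrow$; (iii) for every compact $K\subset\mathbb R^4_\uparrow$ there is a constant $b_K>0$ such that the set of $z$ where the maximum in $( * )$ is attained is contained in $[-b_K,b_K]$ for all $(x,s;y,t)\in K$ and $r\in(s,t)$; (iv) for all $r<t$, $x\le x'$ and $y\le y'$, $f(x,r;y,t)+f(x',r;y',t)\ge f(x,r;y',t)+f(x',r;y,t)$. For a continuous $\pi:[t,s]\to\mathbb R$, the length is $\int df\circ\pi=\inf_{k\in\mathbb N}\inf_{t=t_0<t_1<\dots<t_k=s}\sum_{i=1}^kf(\pi(t_{i-1}),t_{i-1};\pi(t_i),t_i)$, and $\pi$ is a geodesic from $(\pi(t),t)$ to $(\pi(s),s)$ if $\int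 df\circ\pi=f(\pi(t),t;\pi(s),s)$. A geodesic $\pi$ from $(x,t)$ to $(y,s)$ is rightmost (leftmost) if $\pi\ge\tau$ (respectively $\pi\le\tau$) for every other geodesic $\tau$ from $(x,t)$ to $(y,s)$. *)

(* Defs.v *)
From HB Require Import structures.
From mathcomp Require Import all_boot all_order all_algebra.
From mathcomp Require Import all_classical all_reals all_analysis.
Set Implicit Arguments.
Unset Strict Implicit.
Unset Printing Implicit Defensive.
Import Order.TTheory GRing.Theory Num.Theory.
Import numFieldNormedType.Exports.
Local Open Scope classical_set_scope.
Local Open Scope ring_scope.

(* The point written (x,t;y,s) on paper is ((x, t), (y, s)). Functions on the
   domain R4up are total functions on R4 of which only the values on R4up are
   ever used; likewise a path on [t, s] is a total function R -> R of which
   only the restriction to [t, s] is used. *)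
Notation R4 R := ((R * R) * (R * R))%type.

Section Landscapes.
Variable R : realType.

Definition R4up : set (R4 R) := [set p | p.1.2 < p.2.2].

Definition via (f : R4 R -> \bar R) (p : R4 R) (r z : R) : \bar R :=
  (f (p.1, (z, r)) + f ((z, r), p.2))%E.

Definition maximizers (g : R -> \bar R) : set R :=
  [set z | forall w, (g w <= g z)%E].

Definition landscape (f : R4 R -> \bar R) : Prop :=
  (forall p, R4up p -> (f p < +oo)%E) /\
  (forall x y s r t : R, s < r -> r < t ->
     exists2 z, maximizers (via f ((x, s), (y, t)) r) z &
       f ((x, s), (y, t)) = via f ((x, s), (y, t)) r z).

Definition parabolic_bound (f : R4 R -> R) : Prop :=
  forall b : R, exists c : R, forall x t y s : R,
    0 < s ->
    x \in `[- b, b] -> t \in `[- b, b] -> y \in `[- b, b] ->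
    t + s \in `[- b, b] ->
    `| f ((x, t), (y, t + s)) + (x - y) ^+ 2 / s | <= c.

Definition bounded_maximizers (f : R4 R -> R) : Prop :=
  forall K : set (R4 R), compact K -> K `<=` R4up ->
    exists2 b : R, 0 < b & forall x s y t r : R,
      K ((x, s), (y, t)) -> s < r -> r < t ->
      maximizers (via (EFin \o f) ((x, s), (y, t)) r) `<=` `[- b, b].

Definition quadrangle_inequality (f : R4 R -> R) : Prop :=
  forall r t x x' y y' : R, r < t -> x <= x' -> y <= y' ->
    f ((x, r), (y', t)) + f ((x', r), (y, t)) <=
    f ((x, r), (y, t)) + f ((x', r), (y', t)).

Definition proper_landscape (f : R4 R -> R) : Prop :=
  [/\ landscape (EFin \o f),
      {within R4up, continuous f},
      parabolic_bound f,
      bounded_maximizers f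
    & quadrangle_inequality f].

(* u 0 < ... < u k subdivides [t, s]; for t < s there is none with k = 0, and
   the inner infimum below is then +oo, which does not affect the outer one. *)
Definition subdivision (t s : R) (k : nat) (u : nat -> R) : Prop :=
  [/\ u 0%N = t, u k = s & forall i, (i < k)%N -> u i < u i.+1].

Definition path_length (f : R4 R -> \bar R) (pi : R -> R) (t s : R) : \bar R :=
  ereal_inf (range (fun k : nat =>
    ereal_inf [set (\sum_(i < k)
        f ((pi (u i), u i), (pi (u i.+1), u i.+1)))%E
      | u in subdivision t s k])).

Definition geodesic (f : R4 R -> \bar R) (x t y s : R) (pi : R -> R) : Prop :=
  [/\ {within `[t, s], continuous pi}, pi t = x, pi s = y
    & path_length f pi t s = f ((x, t), (y, s))].

Definition rightmost_geodesic (f : R4 R -> \bar R) (x t y s : R)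
    (pi : R -> R) : Prop :=
  geodesic f x t y s pi /\
  forall tau, geodesic f x t y s tau ->
    forall r, r \in `[t, s] -> tau r <= pi r.

Definition leftmost_geodesic (f : R4 R -> \bar R) (x t y s : R)
    (pi : R -> R) : Prop :=
  geodesic f x t y s pi /\
  forall tau, geodesic f x t y s tau ->
    forall r, r \in `[t, s] -> pi r <= tau r.

End Landscapes.

(* Main.v *)
(* Let M_r be the set of maximizers z of f(x,t;z,r) + f(z,r;y,s), a nonempty
   compact set, and let pi(r) be its maximum (or minimum). Every geodesic tau
   has tau(r) in M_r, so only pi has to be shown to be a geodesic. For r < r',
   the quadrangle inequality swaps optimal continuations from pi(r) and to
   pi(r') and shows that f is additive along pi, so that all subdivision sums
   telescope to f(x,t;y,s). The increments of f along pi are therefore bounded,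
   and the parabolic bound makes pi Hoelder continuous of exponent 1/2. *)
Require Import Defs.
From mathcomp Require Import all_boot all_order all_algebra.
From mathcomp Require Import all_classical all_reals all_analysis.
From mathcomp Require Import ring lra.
Import Order.TTheory GRing.Theory Num.Theory.
Import numFieldNormedType.Exports.
Local Open Scope classical_set_scope.
Local Open Scope ring_scope.

(** * Extrema of closed bounded sets, and continuity criteria *)

Lemma closed_bounded_has_max (R : realType) (A : set R) :
  (A !=set0) -> closed A -> has_ubound A ->
  exists2 m, A m & ubound A m.
Proof.
move=> A0 cA uA; exists (sup A); first exact/cA/closure_sup.
by move=> z Az; apply: ub_le_sup.
Qed.

Lemma closed_bounded_has_min (R : realType) (A : set R) :
  (A !=set0) -> closed A -> has_lbound A ->
  exists2 m, A m & lbound A m.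
Proof.
move=> [a Aa] cA [l lA].
have [|||m Am um] := @closed_bounded_has_max R (-%R @^-1` A).
- by exists (- a); rewrite /= opprK.
- by apply: preimage_closed => // z _; exact: opp_continuous.
- by exists (- l) => z /lA; rewrite lerNr.
by exists (- m) => // z Az; rewrite lerNl; apply: um; rewrite /= opprK.
Qed.

Lemma continuous_pair (S T U : topologicalType) (g : S -> T) (h : S -> U) :
  continuous g -> continuous h -> continuous (fun z => (g z, h z)).
Proof. by move=> cg ch z; exact: (cvg_pair (cg z) (ch z)). Qed.

(** Relative neighbourhoods suffice because [h] never leaves [A]. This serves slices of [f], known
    to be continuous only on [R4up]. *)
Lemma continuous_comp_within (S T U : topologicalType) (A : set T)
    (g : T -> U) (h : S -> T) :
  {within A, continuous g} -> continuous h -> (forall z, A (h z)) ->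
  continuous (g \o h).
Proof.
move=> /subspace_continuousP cg ch Ah z B /(cg _ (Ah z)) gB.
have gAB : nbhs (h z) [set q | A q -> B (g q)] := gB.
by have := ch z _ gAB; apply: (@filterS _ (nbhs z)) => w; exact.
Qed.

(** Hölder continuity of exponent 1/2, squared to match the parabolic bound. *)
Lemma continuous_sqr_modulus (R : realType) (A : set R) (g : R -> R) (C : R) :
  (forall a b, A a -> A b -> a < b -> (g a - g b) ^+ 2 <= C * (b - a)) ->
  {within A, continuous g}.
Proof.
move=> gC; apply/subspace_continuousP => a Aa.
apply/cvgrPdist_lt => e e0.
(* Chosen so that d (|C| + 1) = e^2; the added 1 keeps the denominator positive. *)
pose d := e ^+ 2 / (`|C| + 1).
have C1 : 0 < `|C| + 1 by rewrite ltr_wpDl.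
have d0 : 0 < d by rewrite divr_gt0// exprn_gt0.
have key u v : A u -> A v -> u < v -> v - u < d -> `|g u - g v| < e.
  move=> Au Av uv uvd; rewrite -ltr_sqr ?nnegrE ?(ltW e0)// real_normK ?num_real//.
  apply: (le_lt_trans (gC u v Au Av uv)).
  apply: (@le_lt_trans _ _ ((`|C| + 1) * (v - u))).
    by rewrite ler_pM2r ?subr_gt0// (le_trans (ler_norm _))// lerDl.
  by rewrite mulrC -ltr_pdivlMr.
rewrite near_withinE; near=> b => Ab.
have : `|a - b| < d by near: b; exact: (nbhsx_ballx a d d0).
case: (ltgtP a b) => [ab|ba|->]; last by rewrite !subrr !normr0.
- by rewrite distrC ger0_norm ?subr_ge0 ?ltW//; exact: key.
- by rewrite ger0_norm ?subr_ge0 ?ltW// distrC; exact: key.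
Unshelve. all: by end_near. Qed.

Section ProperLandscape.
Variables (R : realType) (f : R4 R -> R).
Hypothesis hf : proper_landscape f.

Lemma landscape_triangle (x s z r y t : R) : s < r -> r < t ->
  f ((x, s), (z, r)) + f ((z, r), (y, t)) <= f ((x, s), (y, t)).
Proof.
move=> sr rt; have [[_ hl] _ _ _ _] := hf.
have [w wmax e] := hl x y s r t sr rt.
by have := wmax z; rewrite -e /via /= -EFinD lee_fin.
Qed.

Lemma landscape_midpoint (x s y t r : R) : s < r -> r < t ->
  exists z, f ((x, s), (z, r)) + f ((z, r), (y, t)) = f ((x, s), (y, t)).
Proof.
move=> sr rt; have [[_ hl] _ _ _ _] := hf.
by have [w _ [->]] := hl x y s r t sr rt; exists w.
Qed.

(** * Crossing points at intermediate times, for fixed endpoints *)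

Variables x t y s : R.
Hypothesis hts : t < s.

(** For [t < r < s] these are exactly the maximizers in the composition law, written as a level set
    so that closedness follows from continuity. *)
Definition crossing (r : R) : set R :=
  [set z | f ((x, t), (z, r)) + f ((z, r), (y, s)) = f ((x, t), (y, s))].

Lemma crossing_closed (r : R) : t < r -> r < s -> closed (crossing r).
Proof.
move=> tr rs; have [_ cf _ _ _] := hf.
apply: (@preimage_closed _ _ (fun z => f ((x, t), (z, r)) + f ((z, r), (y, s)))
  [set f ((x, t), (y, s))]); last exact: closed_eq.
move=> z _; apply: cvgD.
- apply: (continuous_comp_within _ _ _ _ f (fun z => ((x, t), (z, r))) cf) => //.
  by apply: continuous_pair => [w|]; [exact: cvg_cst|
    apply: continuous_pair => w; [exact: cvg_id|exact: cvg_cst]].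
- apply: (continuous_comp_within _ _ _ _ f (fun z => ((z, r), (y, s))) cf) => //.
  by apply: continuous_pair => [|w]; [|exact: cvg_cst];
    apply: continuous_pair => w; [exact: cvg_id|exact: cvg_cst].
Qed.

(** The bound on maximizers, taken for the compact singleton of the endpoints, is uniform in the
    intermediate time. *)
Lemma crossing_bounded : exists b, forall r z,
  t < r -> r < s -> crossing r z -> - b <= z <= b.
Proof.
have [_ _ _ hb _] := hf.
have [|p /= ->//|b _ hb'] := hb [set ((x, t), (y, s))].
  exact: compact_set1.
exists b => r z tr rs zr.
have := hb' x t y s r erefl tr rs z; rewrite /= in_itv; apply => w.
by rewrite /via /= -!EFinD lee_fin zr; exact: landscape_triangle.
Qed.

Lemma crossing_max (r : R) : t < r -> r < s ->
  exists2 z, crossing r z & ubound (crossing r) z.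
Proof.
move=> tr rs; apply: closed_bounded_has_max.
- by have [z] := landscape_midpoint x t y s r tr rs; exists z.
- exact: crossing_closed.
- have [b hb] := crossing_bounded.
  by exists b => z /(hb _ _ tr rs) /andP[].
Qed.

Lemma crossing_min (r : R) : t < r -> r < s ->
  exists2 z, crossing r z & lbound (crossing r) z.
Proof.
move=> tr rs; apply: closed_bounded_has_min.
- by have [z] := landscape_midpoint x t y s r tr rs; exists z.
- exact: crossing_closed.
- have [b hb] := crossing_bounded.
  by exists (- b) => z /(hb _ _ tr rs) /andP[].
Qed.

(** Take [w'] optimal from [(z, r)] to [(y, s)] and [w] optimal from [(x, t)] to [(z', r')]. Both
    are crossings, so extremality orders [w, z] and [w', z'] the same way. The quadrangle inequality
    then bounds [f] from [(z, r)] to [(z', r')] below; the triangle inequality bounds it above. *)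
Lemma crossing_extremal_additive (r r' z z' : R) :
  t < r -> r < r' -> r' < s -> crossing r z -> crossing r' z' ->
  (ubound (crossing r) z /\ ubound (crossing r') z') \/
  (lbound (crossing r) z /\ lbound (crossing r') z') ->
  f ((x, t), (z, r)) + f ((z, r), (z', r')) = f ((x, t), (z', r')).
Proof.
move=> tr rr' r's zr z'r' ext.
have rs := lt_trans rr' r's; have tr' := lt_trans tr rr'.
have [_ _ _ _ hq] := hf.
have [w' hw'] := landscape_midpoint z r y s r' rr' r's.
have [w hw] := landscape_midpoint x t z' r' r tr rr'.
rewrite /crossing /= in zr z'r'.
have T1 a b := landscape_triangle x t a r b r' tr rr'.
have T2 a b := landscape_triangle a r b r' y s rr' r's.
have T3 a := landscape_triangle x t a r y s tr rs.
have T4 a := landscape_triangle x t a r' y s tr' r's.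
(* Going through [w], then [z'], to [(y, s)] already attains the full value. *)
have cw : crossing r w.
  by rewrite /crossing /=; have := T2 w z'; have := T3 w; lra.
have cw' : crossing r' w'.
  by rewrite /crossing /=; have := T1 z w'; have := T4 w'; lra.
have Q : f ((w, r), (z', r')) + f ((z, r), (w', r')) <=
         f ((w, r), (w', r')) + f ((z, r), (z', r')).
  case: ext => -[e e'].
    exact: (hq _ _ _ _ _ _ rr' (e _ cw) (e' _ cw')).
  have := hq _ _ _ _ _ _ rr' (e _ cw) (e' _ cw'); lra.
have := T1 w w'; have := T1 z z'; have := T4 w'.
rewrite /crossing /= in cw cw'.
lra.
Qed.

(** The length is at most the sum over the subdivision [t < r < s]; the triangle inequality gives
    the converse. *)
Lemma geodesic_crossing (tau : R -> R) (r : R) :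
  geodesic (EFin \o f) x t y s tau -> t < r -> r < s -> crossing r (tau r).
Proof.
move=> [_ taut taus len] tr rs; apply/eqP; rewrite eq_le; apply/andP; split.
  exact: landscape_triangle.
rewrite -lee_fin -[leLHS]len /path_length.
apply: (le_trans (ereal_inf_lbound _)); first by exists 2%N.
apply: ereal_inf_lbound.
exists (fun i => if i is i'.+1 then if i' is 0%N then r else s else t).
  by split=> // -[|[|]].
by rewrite !big_ord_recl big_ord0 /= taut taus adde0.
Qed.

(** * Paths along which [f] is the increment of a potential [G] *)

Section Additive.
Variables (pi G : R -> R).
Hypothesis pit : pi t = x.
Hypothesis pis : pi s = y.
Hypothesis pi_additive : forall r r', t <= r -> r < r' -> r' <= s ->
  f ((pi r, r), (pi r', r')) = G r' - G r.

(** A single interval gives the upper bound; every subdivision sum telescopes to [G s - G t], which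
    gives the lower one. *)
Lemma additive_path_length :
  path_length (EFin \o f) pi t s = (EFin \o f) ((x, t), (y, s)).
Proof.
apply/eqP; rewrite eq_le; apply/andP; split.
  apply: (le_trans (ereal_inf_lbound _)); first by exists 1%N.
  apply: ereal_inf_lbound; exists (fun i => if i is 0%N then t else s).
    by split=> // -[|].
  by rewrite big_ord_recl big_ord0 /= pit pis adde0.
apply: le_ereal_inf_tmp => _ [k _ <-]; apply: le_ereal_inf_tmp => _ [u [u0 uk uS] <-].
have tu i : (i <= k)%N -> t <= u i.
  elim: i => [|i ih ik]; first by rewrite u0.
  by rewrite (le_trans (ih (ltnW ik)))// ltW// uS.
have us i : (i <= k)%N -> u i <= s.
  (* Descending induction from [u k = s]. *)
  move=> ik; rewrite -(subKn ik); elim: (k - i)%N => [|j ih].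
    by rewrite subn0 uk.
  case: (ltnP j k) => jk; last first.
    (* Truncated subtraction makes both indices 0 here. *)
    by apply: le_trans ih; rewrite (eqP jk) (eqP (leqW jk)).
  by apply: le_trans ih; rewrite -(subnSK jk) ltW// uS// subnSK// leq_subr.
rewrite (eq_bigr (fun i : 'I_k => (G (u i.+1) - G (u i))%:E)); last first.
  move=> [i ik] _ /=; rewrite pi_additive ?tu ?uS ?us//; exact: ltnW.
rewrite sumEFin lee_fin -(big_mkord xpredT (fun i => G (u i.+1) - G (u i))).
by rewrite telescope_sumr// u0 uk -pi_additive// pit pis.
Qed.

(** Increments of [f] along [pi] are at least [- (2 * C)], so the parabolic bound leaves at most
    [c + 2 * C] for squared displacement over elapsed time. *)
Lemma additive_geodesic (b C : R) :
  (forall r, t <= r -> r <= s -> - b <= pi r <= b) ->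
  (forall r, t <= r -> r <= s -> `|G r| <= C) ->
  geodesic (EFin \o f) x t y s pi.
Proof.
move=> pib GC; split=> //; last exact: additive_path_length.
have [_ _ hp _ _] := hf.
pose B := `|b| + `|t| + `|s|.
have [c hc] := hp B.
have inB v : `|v| <= B -> v \in `[- B, B] by rewrite in_itv /= ler_norml.
apply: (@continuous_sqr_modulus _ _ _ (c + 2 * C)) => u v /=.
rewrite !in_itv /= => /andP[tu us] /andP[tv vs] uv.
have vu : 0 < v - u by rewrite subr_gt0.
have pB r : t <= r -> r <= s -> `|pi r| <= B.
  move=> tr rs; have /andP[p1 p2] := pib r tr rs.
  rewrite /B ler_norml; have := ler_norm b; have := normr_ge0 t; have := normr_ge0 s.
  by move=> *; apply/andP; split; lra.
have rB r : t <= r -> r <= s -> `|r| <= B.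
  move=> tr rs; rewrite /B ler_norml.
  have := ler_norm (- t); rewrite normrN.
  have := ler_norm s; have := normr_ge0 b; have := normr_ge0 t; have := normr_ge0 s.
  by move=> *; apply/andP; split; lra.
have := hc (pi u) u (pi v) (v - u) vu.
rewrite subrKC !inB ?pB ?rB// => /(_ isT isT isT isT).
rewrite pi_additive// => /ler_normlP[_ h].
rewrite -ler_pdivrMr//.
have /ler_normlP[a1 a2] := GC u tu us; have /ler_normlP[a3 a4] := GC v tv vs.
lra.
Qed.
End Additive.

(** * Extremal crossings form a geodesic *)

(** A time gap of at least [e] keeps the parabolic term at most [(2 * b) ^+ 2 / e]. *)
Lemma landscape_bounded (b e : R) : 0 < e ->
  exists C, forall a r a' r', `|a| <= b -> `|r| <= b -> `|a'| <= b -> `|r'| <= b ->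
    r + e <= r' -> `|f ((a, r), (a', r'))| <= C.
Proof.
move=> e0; have [_ _ hp _ _] := hf; have [c hc] := hp b.
exists (c + (2 * b) ^+ 2 / e) => a r a' r' ab rb a'b r'b err'.
have d0 : 0 < r' - r by lra.
have := hc a r a' (r' - r) d0.
rewrite subrKC !in_itv /= -!ler_norml ab rb a'b r'b => /(_ isT isT isT isT) h.
rewrite -[f _](addrK ((a - a') ^+ 2 / (r' - r))).
apply: (le_trans (ler_normB _ _)); apply: lerD => //.
rewrite ger0_norm; last by rewrite divr_ge0 ?sqr_ge0// ltW.
apply: ler_pM; rewrite ?sqr_ge0 ?invr_ge0 ?(ltW d0)//.
- rewrite -(real_normK (num_real (a - a')))  ler_sqr ?nnegrE//; last first.
    by rewrite mulr_ge0// (le_trans _ ab).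
  by apply: (le_trans (ler_normB _ _)); lra.
- by rewrite lef_pV2 ?posrE// ; lra.
Qed.

Lemma extremal_geodesic (pi : R -> R) :
  pi t = x -> pi s = y ->
  (forall r, t < r -> r < s -> crossing r (pi r)) ->
  (forall r, t < r -> r < s -> ubound (crossing r) (pi r)) \/
  (forall r, t < r -> r < s -> lbound (crossing r) (pi r)) ->
  geodesic (EFin \o f) x t y s pi.
Proof.
move=> pit pis pic ext.
(* At time [t] the value of [f] would be taken off [R4up]; 0 is what additivity from [t]
   requires. *)
pose G r := if r == t then 0 else f ((x, t), (pi r, r)).
have [b0 hb0] := crossing_bounded.
pose b := `|b0| + `|x| + `|y| + `|t| + `|s|.
have nb0 := normr_ge0 b0; have nx := normr_ge0 x; have ny := normr_ge0 y.
have nt := normr_ge0 t; have ns := normr_ge0 s.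
have xb : `|x| <= b by rewrite /b; lra.
have yb : `|y| <= b by rewrite /b; lra.
have pib r : t <= r -> r <= s -> `|pi r| <= b.
  rewrite [t <= r]le_eqVlt => /predU1P[<-|tr]; first by rewrite pit.
  rewrite le_eqVlt => /predU1P[->|rs]; first by rewrite pis.
  have /andP[p1 p2] := hb0 r _ tr rs (pic r tr rs).
  by rewrite ler_norml /b; have := ler_norm b0 => ?; apply/andP; split; lra.
have rb r : t <= r -> r <= s -> `|r| <= b.
  move=> tr rs; rewrite /b ler_norml.
  have := ler_norm (- t); rewrite normrN; have := ler_norm s.
  by move=> *; apply/andP; split; lra.
(* With [e] half the duration, every time is at least [e] away from [t] or from [s]. *)
have [e e0 he] : exists2 e, 0 < e & s = t + e + e.
  by exists ((s - t) / 2); [rewrite divr_gt0// subr_gt0|field].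
have [C hC] := landscape_bounded b e e0.
have F0 : `|f ((x, t), (y, s))| <= C.
  by apply: hC => //; rewrite ?rb ?(ltW hts)//; lra.
have C0 : 0 <= C by apply: le_trans F0.
(* For r in the left half of [t, s], G r is controlled through the crossing
   identity, since f itself is unbounded near the diagonal. *)
have GC r : t <= r -> r <= s -> `|G r| <= 2 * C.
  move=> tr rs; rewrite /G; case: eqVneq => [_|rt]; first by rewrite normr0 mulr_ge0.
  have tr' : t < r by rewrite lt_neqAle eq_sym rt.
  have [h|h] := leP (t + e) r.
    apply: (@le_trans _ _ C); last by lra.
    by apply: hC => //; rewrite ?pib ?rb ?(ltW hts).
  have rs' : r < s by lra.
  have -> : f ((x, t), (pi r, r)) = f ((x, t), (y, s)) - f ((pi r, r), (y, s)).
    by rewrite -(pic r tr' rs') addrK.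
  apply: (le_trans (ler_normB _ _)); rewrite mulr_natl mulr2n; apply: lerD => //.
  by apply: hC => //; rewrite ?pib ?rb ?(ltW hts)//; lra.
apply: (@additive_geodesic pi G pit pis _ b (2 * C)) => //; last first.
  by move=> r tr rs; rewrite -ler_norml pib.
move=> r r' tr rr' r's.
have tr' := le_lt_trans tr rr'; have rs := lt_le_trans rr' r's.
rewrite /G (gt_eqF tr').
(* Endpoints are separate: [r = t] uses the value 0 of [G], and [r' = s] is the crossing
   identity. *)
move: tr; rewrite le_eqVlt => /predU1P[<-|tr]; first by rewrite eqxx subr0 pit.
rewrite (gt_eqF tr); apply/eqP; rewrite eq_sym subr_eq addrC; apply/eqP/esym.
move: r's; rewrite le_eqVlt => /predU1P[->|r's]; first by rewrite pis; exact: pic.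
apply: crossing_extremal_additive => //; [exact: pic|exact: pic|].
by case: ext => h; [left|right]; split; exact: h.
Qed.

(** * Existence of the two geodesics *)

Lemma rightmost_geodesic_exists :
  exists pi, rightmost_geodesic (EFin \o f) x t y s pi.
Proof.
(* The bounds on [r] sit inside the existential so that choice yields a total [m], arbitrary outside
   the open interval. *)
have /choice[m hm] r : exists z, t < r -> r < s -> crossing r z /\ ubound (crossing r) z.
  have [tr|tr] := ltP t r; last by exists 0.
  have [rs|rs] := ltP r s; last by exists 0.
  by have [z] := crossing_max r tr rs; exists z.
(* At [t] and [s] a crossing would involve [f] off its domain, so the endpoints are imposed. *)
pose pi r := if r == t then x else if r == s then y else m r.
have pit : pi t = x by rewrite /pi eqxx.
have pis : pi s = y by rewrite /pi eqxx (gt_eqF hts).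
have piE r : t < r -> r < s -> pi r = m r.
  by move=> tr rs; rewrite /pi (gt_eqF tr) (lt_eqF rs).
exists pi; split.
  apply: extremal_geodesic => //; last left; move=> r tr rs; rewrite piE//;
    by case: (hm r tr rs).
move=> tau gtau r; rewrite in_itv /= => /andP[]; have [_ taut taus _] := gtau.
rewrite le_eqVlt => /predU1P[<-|tr]; first by rewrite taut pit.
rewrite le_eqVlt => /predU1P[->|rs]; first by rewrite taus pis.
by rewrite piE//; have [_] := hm r tr rs; apply; exact: geodesic_crossing.
Qed.

Lemma leftmost_geodesic_exists :
  exists pi, leftmost_geodesic (EFin \o f) x t y s pi.
Proof.
have /choice[m hm] r : exists z, t < r -> r < s -> crossing r z /\ lbound (crossing r) z.
  have [tr|tr] := ltP t r; last by exists 0.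
  have [rs|rs] := ltP r s; last by exists 0.
  by have [z] := crossing_min r tr rs; exists z.
pose pi r := if r == t then x else if r == s then y else m r.
have pit : pi t = x by rewrite /pi eqxx.
have pis : pi s = y by rewrite /pi eqxx (gt_eqF hts).
have piE r : t < r -> r < s -> pi r = m r.
  by move=> tr rs; rewrite /pi (gt_eqF tr) (lt_eqF rs).
exists pi; split.
  apply: extremal_geodesic => //; last right; move=> r tr rs; rewrite piE//;
    by case: (hm r tr rs).
move=> tau gtau r; rewrite in_itv /= => /andP[]; have [_ taut taus _] := gtau.
rewrite le_eqVlt => /predU1P[<-|tr]; first by rewrite taut pit.
rewrite le_eqVlt => /predU1P[->|rs]; first by rewrite taus pis.
by rewrite piE//; have [_] := hm r tr rs; apply; exact: geodesic_crossing.
Qed.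

End ProperLandscape.

Theorem lemma13p2 (R : realType) (f : R4 R -> R) (hf : proper_landscape f)
    (x t y s : R) (hts : R4up ((x, t), (y, s))) :
  (exists pi : R -> R, rightmost_geodesic (EFin \o f) x t y s pi) /\
  (exists pi : R -> R, leftmost_geodesic (EFin \o f) x t y s pi).
Proof.
split; [exact: rightmost_geodesic_exists | exact: leftmost_geodesic_exists].
Qed.
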